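(* Let $r(x)=\sum_{n=0}^{\infty}x^{2^n-1}$, let $b$ be an indeterminate, and let $$r_{b,1}^{(1)}(x)=\frac{1+b(x^2+x^6+x^{14}+\cdots)}{1+x+bx^3+bx^7+bx^{15}+\cdots}=\frac{1+b\sum_{j\ge2}x^{2^j-2}}{1+x+b\sum_{j\ge2}x^{2^j-1}}\in\mathbb{Z}[b][[x]].$$ Then the coefficient array of $r_{b,1}^{(1)}(x)$, that is, the matrix whose $(n,k)$ entry ($n,k\ge0$) is the coefficient of $b^k$ in the polynomial $[x^n]\,r_{b,1}^{(1)}(x)\in\mathbb{Z}[b]$, is the stretched Riordan array $$\left(\frac{-1}{1+x},\ \frac{-x^3\,r(x^4)}{1+x}\right)$$ with its first row removed. That is, if $(m_{n,k})_{n,k\ge0}$ denotes this stretched Riordan array, then the $(n,k)$ entry of the coefficient array equals $m_{n+1,k}$ for all $n,k\ge0$.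
   Context: $[x^n]$ denotes extraction of the coefficient of $x^n$ in a power series. For power series $g(x)$ with $g(0)\neq0$ and $f(x)$ with $f(0)=0$, the array $(g(x),f(x))$ is the infinite matrix $(m_{n,k})_{n,k\ge0}$ with $m_{n,k}=[x^n]\,g(x)f(x)^k$; it is called a Riordan array when the coefficient of $x$ in $f$ is nonzero, and a stretched Riordan array when $f$ is allowed to start with a higher power of $x$ (here $x^3$). The series $r(x)=1+x+x^3+x^7+\cdots$ is the generating function of the Rueppel sequence. The series $r_{b,1}^{(1)}(x)$ arises from the generalized Rueppel generating function $b\,r(x)-(b-1)+(1-b)x=1+x+b(x^3+x^7+x^{15}+\cdots)$ through the relation $b\,r(x)-(b-1)+(1-b)x=\dfrac{1}{1-x\,r_{b,1}^{(1)}(x)}$. *)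

(* Defs.v *)
From HB Require Import structures.
From mathcomp Require Import all_boot all_order all_algebra.
From mathcomp Require Import all_classical.

Set Implicit Arguments.
Unset Strict Implicit.
Unset Printing Implicit Defensive.
Import GRing.Theory.
Local Open Scope ring_scope.

(* Formal power series in one variable: [fps R] is R[[x]], a series being
   given by its sequence of coefficients, and [coefs f n] is [x^n] f. *)

Record fps (R : Type) := Fps { coefs : nat -> R }.

Lemma fpsP (R : Type) (f g : fps R) : coefs f =1 coefs g <-> f = g.
Proof.
split=> [|-> //]; case: f g => [f] [g] /= fg.
by congr Fps; apply: funext.
Qed.

HB.instance Definition _ (R : Type) := gen_eqMixin (fps R).
HB.instance Definition _ (R : Type) := gen_choiceMixin (fps R).

Definition fps_const (R : nzRingType) (c : R) : fps R :=
  Fps (fun n => if n is 0%N then c else 0).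

Definition fps_X (R : nzRingType) : fps R := Fps (fun n => (n == 1%N)%:R).
Arguments fps_X {R}.

Definition fps_opp (R : nzRingType) (f : fps R) : fps R :=
  Fps (fun n => - coefs f n).

Definition fps_add (R : nzRingType) (f g : fps R) : fps R :=
  Fps (fun n => coefs f n + coefs g n).

Definition fps_mul (R : nzRingType) (f g : fps R) : fps R :=
  Fps (fun n => \sum_(i < n.+1) coefs f i * coefs g (n - i)).

Lemma fps_addA (R : nzRingType) : associative (@fps_add R).
Proof. by move=> f g h; apply/fpsP => n /=; rewrite addrA. Qed.

Lemma fps_addC (R : nzRingType) : commutative (@fps_add R).
Proof. by move=> f g; apply/fpsP => n /=; rewrite addrC. Qed.

Lemma fps_add0 (R : nzRingType) : left_id (fps_const (0 : R)) (@fps_add R).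
Proof. by move=> f; apply/fpsP => -[|n] /=; rewrite add0r. Qed.

Lemma fps_addN (R : nzRingType) :
  left_inverse (fps_const (0 : R)) (@fps_opp R) (@fps_add R).
Proof. by move=> f; apply/fpsP => -[|n] /=; rewrite addNr. Qed.

HB.instance Definition _ (R : nzRingType) :=
  GRing.isZmodule.Build (fps R)
    (@fps_addA R) (@fps_addC R) (@fps_add0 R) (@fps_addN R).

Definition fps_trunc (R : nzRingType) (n : nat) (f : fps R) : {poly R} :=
  \poly_(i < n.+1) coefs f i.

Lemma coef_fps_trunc (R : nzRingType) (n : nat) (f : fps R) (i : nat) :
  (i <= n)%N -> (fps_trunc n f)`_i = coefs f i.
Proof. by move=> le_in; rewrite coef_poly ltnS le_in. Qed.

Lemma coefs_mul_trunc (R : nzRingType) (n : nat) (f g : fps R) (i : nat) :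
  (i <= n)%N -> coefs (fps_mul f g) i = (fps_trunc n f * fps_trunc n g)`_i.
Proof.
move=> le_in; rewrite coefM /=; apply: eq_bigr => j _.
have le_jn : (j <= n)%N by apply: leq_trans le_in; rewrite -ltnS.
have le_ijn : (i - j <= n)%N by apply: leq_trans le_in; apply: leq_subr.
by rewrite !coef_fps_trunc.
Qed.

Lemma fps_mulA (R : nzRingType) : associative (@fps_mul R).
Proof.
move=> f g h; apply/fpsP => n.
have -> : coefs (fps_mul f (fps_mul g h)) n
          = (fps_trunc n f * (fps_trunc n g * fps_trunc n h))`_n.
  rewrite coefM; apply: eq_bigr => j _.
  rewrite -(coefs_mul_trunc g h (leq_subr j n)) coef_fps_trunc //.
  by rewrite -ltnS.
have -> : coefs (fps_mul (fps_mul f g) h) n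
          = (fps_trunc n f * fps_trunc n g * fps_trunc n h)`_n.
  rewrite coefM; apply: eq_bigr => j _.
  have le_jn : (j <= n)%N by rewrite -ltnS.
  by rewrite -(coefs_mul_trunc f g le_jn) coef_fps_trunc ?leq_subr.
by rewrite mulrA.
Qed.

Lemma fps_mulC (R : comNzRingType) : commutative (@fps_mul R).
Proof.
by move=> f g; apply/fpsP => n; rewrite !(@coefs_mul_trunc R n) // mulrC.
Qed.

Lemma fps_mul1 (R : nzRingType) : left_id (fps_const (1 : R)) (@fps_mul R).
Proof.
move=> f; apply/fpsP => n /=; rewrite big_ord_recl /= mul1r subn0.
by rewrite big1 ?addr0 // => i _; rewrite mul0r.
Qed.

Lemma fps_mulDl (R : nzRingType) :
  left_distributive (@fps_mul R) (@fps_add R).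
Proof.
move=> f g h; apply/fpsP => n /=; rewrite -big_split /=.
by apply: eq_bigr => i _; rewrite mulrDl.
Qed.

Lemma fps_oner_neq0 (R : nzRingType) : fps_const (1 : R) != 0.
Proof.
by apply/eqP => /fpsP /(_ 0%N) /= /eqP; rewrite oner_eq0.
Qed.

HB.instance Definition _ (R : comNzRingType) :=
  GRing.Zmodule_isComNzRing.Build (fps R)
    (@fps_mulA R) (@fps_mulC R) (@fps_mul1 R) (@fps_mulDl R)
    (@fps_oner_neq0 R).

Fixpoint fps_inv_seq (R : unitRingType) (f : fps R) (n : nat) : seq R :=
  if n is m.+1 then
    let s := fps_inv_seq f m in
    rcons s (- (coefs f 0)^-1 * \sum_(i < m.+1) coefs f i.+1 * s`_(m - i))
  else [:: (coefs f 0)^-1].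

Definition fps_unit (R : unitRingType) : {pred fps R} :=
  fun f => coefs f 0 \is a GRing.unit.

(* As for every unitRingType, the inverse of a non-unit is itself. *)
Definition fps_inv (R : unitRingType) (f : fps R) : fps R :=
  if fps_unit f then Fps (fun n => (fps_inv_seq f n)`_n) else f.

Lemma size_fps_inv_seq (R : unitRingType) (f : fps R) (n : nat) :
  size (fps_inv_seq f n) = n.+1.
Proof. by elim: n => //= n IHn; rewrite size_rcons IHn. Qed.

Lemma nth_fps_inv_seq (R : unitRingType) (f : fps R) (n i : nat) :
  (i <= n)%N -> (fps_inv_seq f n)`_i = (fps_inv_seq f i)`_i.
Proof.
elim: n => [|n IHn]; first by rewrite leqn0 => /eqP->.
rewrite leq_eqVlt => /predU1P[-> //|]; rewrite ltnS => le_in.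
by rewrite /= nth_rcons size_fps_inv_seq ltnS le_in IHn.
Qed.

Lemma fps_mulV (R : comUnitRingType) :
  {in @fps_unit R, left_inverse (1 : fps R) (@fps_inv R) *%R}.
Proof.
move=> f Uf; rewrite mulrC; apply/fpsP => -[|n] /=.
  rewrite big_ord1 /fps_inv; have -> : fps_unit f by [].
  by rewrite /= divrr.
rewrite big_ord_recl /fps_inv; have -> : fps_unit f by [].
rewrite /= nth_rcons size_fps_inv_seq ltnn eqxx mulrA mulrN divrr // mulN1r.
apply/eqP; rewrite addrC subr_eq0; apply/eqP; apply: eq_bigr => i _.
by rewrite /bump /= add1n subSS (nth_fps_inv_seq f (leq_subr i n)).
Qed.

Lemma fps_unitPl (R : comUnitRingType) (f g : fps R) :
  g * f = 1 -> fps_unit f.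
Proof.
move=> /fpsP /(_ 0%N) /=; rewrite big_ord1 => gf1.
by apply/unitrPr; exists (coefs g 0); rewrite mulrC.
Qed.

Lemma fps_inv_out (R : comUnitRingType) :
  {in [predC @fps_unit R], @fps_inv R =1 id}.
Proof.
by move=> f Uf; rewrite /fps_inv ifN.
Qed.

HB.instance Definition _ (R : comUnitRingType) :=
  GRing.ComNzRing_hasMulInverse.Build (fps R)
    (@fps_mulV R) (@fps_unitPl R) (@fps_inv_out R).

(* Sum of the family (F j), j in A, taken coefficientwise: meaningful when,
   for each n, only finitely many j in A have a nonzero coefficient of x^n
   in F j (the library's finitely supported sum is 0 otherwise). *)
Definition fps_sum (R : nzRingType) (A : set nat) (F : nat -> fps R) : fps R :=
  Fps (fun n => \sum_(j \in A) coefs (F j) n).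

(* f(g(x)), for g with g(0) = 0. *)
Definition fps_comp (R : comNzRingType) (f g : fps R) : fps R :=
  fps_sum [set: nat] (fun j => fps_const (coefs f j) * g ^+ j).

Definition riordan_array (R : comNzRingType) (g f : fps R) (n k : nat) : R :=
  coefs (g * f ^+ k) n.

(* A Riordan array proper asks moreover for coefs f 1 != 0; here f may have any
   order >= 1. *)
Definition stretched_riordan_pair (R : comNzRingType) (g f : fps R) : Prop :=
  [/\ coefs g 0 != 0, coefs f 0 = 0 & f != 0].

Definition rueppel (R : comNzRingType) : fps R :=
  fps_sum [set: nat] (fun n => fps_X ^+ (2 ^ n - 1)).
Arguments rueppel {R}.

(* Z[b] is {poly int}, with b the polynomial variable; this is b as a constant
   of Z[b][[x]]. *)
Definition fps_b : fps {poly int} := fps_const 'X.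

Definition r_b1_1 : fps {poly int} :=
  (1 + fps_b * fps_sum [set j | (2 <= j)%N] (fun j => fps_X ^+ (2 ^ j - 2)))
  / (1 + fps_X
       + fps_b * fps_sum [set j | (2 <= j)%N] (fun j => fps_X ^+ (2 ^ j - 1))).

Definition coef_array (r : fps {poly int}) (n k : nat) : int :=
  (coefs r n)`_k.

(* Main.v *)
Require Import Defs.
From HB Require Import structures.
From mathcomp Require Import all_boot all_order all_algebra.
From mathcomp Require Import all_classical.

Set Implicit Arguments.
Unset Strict Implicit.
Unset Printing Implicit Defensive.
Import GRing.Theory.
Local Open Scope ring_scope.

(** Write [S = x^3 + x^7 + x^15 + ...] and [u = 1 + x]. The denominator of
    [r_b1_1] is [D = u + b S], and its numerator [N] satisfies [x N = D - 1].
    Hence [x r_b1_1 = 1 - 1/D], which is why the array appears shifted by one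
    row and with a minus sign: the coefficient of [x^n] in [r_b1_1] is minus
    that of [x^(n+1)] in [1/D].

    It remains to read [1/D] as a power series in [b]. If [H_k] denotes the
    coefficient of [b^k] in [1/D], itself a series in [x] ([fps_slice]), then
    comparing the coefficients of [b^k] in [D (1/D) = 1] gives
    [u H_0 = 1] and [u H_(k+1) + S H_k = 0]. So [H_k] is geometric,
    [H_k = (1/u) (- S/u)^k] ([fps_slice_inv_affine]), and this needs no
    expansion of [1/D] as an infinite sum. Finally [S = x^3 r(x^4)]
    ([rueppel_tailE]), so [- H_k] is the [k]-th column of the stretched
    Riordan array. *)

(** * Coefficients of monomials, monomial multiples and substitutions *)

Section Coefficients.
Variable R : comNzRingType.
Implicit Types (f : fps R) (n m : nat).

Lemma coefsD f g n : coefs (f + g) n = coefs f n + coefs g n.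
Proof. by []. Qed.

Lemma coefsN f n : coefs (- f) n = - coefs f n.
Proof. by []. Qed.

Lemma coefs1 n : coefs (1 : fps R) n = (n == 0%N)%:R.
Proof. by case: n. Qed.

Lemma coefsM f g n :
  coefs (f * g) n = \sum_(i < n.+1) coefs f i * coefs g (n - i).
Proof. by []. Qed.

Lemma coefs_sum (A : set nat) (F : nat -> fps R) n :
  coefs (fps_sum A F) n = \sum_(j \in A) coefs (F j) n.
Proof. by []. Qed.

Lemma coefs_constM c f n : coefs (fps_const c * f) n = c * coefs f n.
Proof.
rewrite coefsM big_ord_recl /= subn0 big1 ?addr0 // => i _.
by rewrite mul0r.
Qed.

Lemma coefs_XM f n :
  coefs (fps_X * f) n = if n is n'.+1 then coefs f n' else 0.
Proof.
case: n => [|n]; first by rewrite coefsM big_ord1 /= mul0r.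
rewrite coefsM big_ord_recl /= mul0r add0r big_ord_recl /= mul1r subn1.
by rewrite big1 ?addr0 // => i _; rewrite mul0r.
Qed.

Lemma coefs_XnM m f n :
  coefs (fps_X ^+ m * f) n = if (n < m)%N then 0 else coefs f (n - m).
Proof.
elim: m n => [|m IHm] n; first by rewrite expr0 mul1r subn0.
by rewrite exprS -mulrA coefs_XM; case: n => [|n] //; rewrite IHm ltnS subSS.
Qed.

Lemma coefs_Xn m n : coefs (fps_X ^+ m : fps R) n = (n == m)%:R.
Proof.
rewrite -[_ ^+ m]mulr1 coefs_XnM coefs1.
by case: ltngtP => [//|mn|->]; rewrite ?subnn // subn_eq0 leqNgt mn.
Qed.

(** The coefficients of both sides agree term by term, so the family need not
    be summable: both sums take the default value 0 at the same places. *)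
Lemma fps_XnM_sum m (A : set nat) (F : nat -> fps R) :
  fps_X ^+ m * fps_sum A F = fps_sum A (fun j => fps_X ^+ m * F j).
Proof.
apply/fpsP => n; rewrite coefs_XnM !coefs_sum.
case: ltnP => nm; first by rewrite fsbig1 // => i _; rewrite coefs_XnM nm.
by apply: eq_fsbigr => i _; rewrite coefs_XnM ltnNge nm.
Qed.

Lemma fsum_only (A : set nat) (F : nat -> R) i :
  A i -> (forall j, A j -> j != i -> F j = 0) -> \sum_(j \in A) F j = F i.
Proof.
move=> Ai F0; have <- : \sum_(j \in [set i]) F j = F i by rewrite fsbig_set1.
apply/esym/fsbig_widen => [_ -> //|].
by move=> j /= [Aj /eqP]; apply: F0.
Qed.

(** Only the term of index [n / d] of the composition contributes to [x^n]. *)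
Lemma coefs_comp_Xn d f n : (0 < d)%N ->
  coefs (fps_comp f (fps_X ^+ d)) n
  = if (d %| n)%N then coefs f (n %/ d) else 0.
Proof.
move=> d_gt0; rewrite /fps_comp coefs_sum.
have termE j : coefs (fps_const (coefs f j) * (fps_X ^+ d) ^+ j) n
               = coefs f j * (n == d * j)%N%:R.
  by rewrite coefs_constM -exprM coefs_Xn.
case: ifPn => dn.
  rewrite (@fsum_only _ _ (n %/ d)%N) //; first last.
    move=> j _; rewrite termE; case: (n =P _) => [->|]; last by rewrite mulr0.
    by rewrite mulKn // eqxx.
  by rewrite termE mulnC divnK // eqxx mulr1.
apply: fsbig1 => j _; rewrite termE; case: eqP => [nE|]; last by rewrite mulr0.
by rewrite nE dvdn_mulr in dn.
Qed.

Lemma fps_comp_sum_Xn d (A : set nat) (e : nat -> nat) : (0 < d)%N ->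
  fps_comp (fps_sum A (fun j => fps_X ^+ e j)) (fps_X ^+ d)
  = fps_sum A (fun j => fps_X ^+ (d * e j)) :> fps R.
Proof.
move=> d_gt0; apply/fpsP => n; rewrite coefs_comp_Xn // !coefs_sum.
case: ifPn => dn.
  apply: eq_fsbigr => j _; rewrite !coefs_Xn.
  by rewrite -[in RHS](divnK dn) mulnC eqn_pmul2l.
apply/esym/fsbig1 => j _; rewrite coefs_Xn; case: eqP => // nE.
by rewrite nE dvdn_mulr in dn.
Qed.

End Coefficients.

(** * The tail of the Rueppel series *)

(** Stated over any ring because the series is needed both with integer
    coefficients, in the Riordan array, and over [Z[b]], in [r_b1_1]. *)
Definition rueppel_tail (R : comNzRingType) : fps R :=
  fps_sum [set j | (2 <= j)%N] (fun j => fps_X ^+ (2 ^ j - 1)).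

(** Shifting the index by two, since [3 + 4 (2^j - 1) = 2^(j + 2) - 1]. *)
Lemma rueppel_tailE (R : comNzRingType) :
  rueppel_tail R = fps_X ^+ 3 * fps_comp (@rueppel R) (fps_X ^+ 4).
Proof.
rewrite /rueppel fps_comp_sum_Xn // fps_XnM_sum.
apply/fpsP => n; rewrite !coefs_sum.
rewrite (reindex_fsbig (addn 2) [set: nat]); last first.
  split=> [i _ //|i j _ _ /addnI //|j /= j2].
  by exists (j - 2)%N => //; rewrite subnKC.
apply: eq_fsbigr => j _; rewrite -exprD; congr (coefs (fps_X ^+ _) n).
by rewrite expnD mulnBr addnBA // leq_pmul2l ?expn_gt0.
Qed.

Lemma coefs_rueppel0 (R : comNzRingType) : coefs (@rueppel R) 0 = 1.
Proof.
rewrite coefs_sum (@fsum_only _ _ _ 0) ?coefs_Xn // => -[|j] // _ _.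
rewrite coefs_Xn; case: eqP => // /esym/eqP.
by rewrite subn_eq0 leqNgt (ltn_exp2l 0).
Qed.

Lemma rueppel_tail_neq0 (R : comNzRingType) : rueppel_tail R != 0.
Proof.
apply/eqP => /fpsP /(_ 3) /eqP.
rewrite rueppel_tailE coefs_XnM ltnn subnn coefs_comp_Xn //.
by rewrite coefs_rueppel0 oner_eq0.
Qed.

(** * Series over a polynomial ring, read by powers of the indeterminate *)

Section Slices.
Variable R : comNzRingType.

Definition fps_polyC (f : fps R) : fps {poly R} :=
  Fps (fun n => (coefs f n)%:P).

(** The coefficient of [b^k] when a series in [x] over [R[b]] is read as a
    series in [b] over [R[[x]]]. *)
Definition fps_slice (k : nat) (h : fps {poly R}) : fps R :=
  Fps (fun n => (coefs h n)`_k).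

Lemma fps_sliceD k g h :
  fps_slice k (g + h) = fps_slice k g + fps_slice k h.
Proof. by apply/fpsP => n /=; rewrite coefD. Qed.

Lemma fps_slice_polyCM k u h :
  fps_slice k (fps_polyC u * h) = u * fps_slice k h.
Proof.
apply/fpsP => n /=; rewrite coef_sum.
by apply: eq_bigr => i _; rewrite coefCM.
Qed.

Lemma fps_slice_bM k h :
  fps_slice k (fps_const 'X * h) = if k is k'.+1 then fps_slice k' h else 0.
Proof.
apply/fpsP => n; rewrite -[LHS]/((coefs (fps_const 'X * h) n)`_k).
rewrite coefs_constM coefXM.
by case: k => //=; case: n.
Qed.

Lemma fps_slice1 k : fps_slice k 1 = (k == 0%N)%:R.
Proof.
by apply/fpsP => -[|n] /=; rewrite ?coef1 ?coef0; case: k.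
Qed.

(** Injectivity of [polyC] is what makes this hold for every family: the two
    coefficientwise sums then have the same support, finite or not. *)
Lemma fps_polyC_sum (A : set nat) (F : nat -> fps R) :
  fps_polyC (fps_sum A F) = fps_sum A (fun j => fps_polyC (F j)).
Proof.
apply/fpsP => n /=; rewrite rmorph_sum /=.
rewrite /finite_support; set P := (A `&` _)%classic; set Q := (A `&` _)%classic.
suff -> : P = Q by [].
apply/seteqP; split=> j [Aj nz]; split=> //= z; apply: nz => /=.
  by apply/eqP; rewrite -polyC_eq0 z.
by rewrite z.
Qed.

Lemma fps_polyC_Xn m : fps_polyC (fps_X ^+ m) = fps_X ^+ m.
Proof. by apply/fpsP => n /=; rewrite !coefs_Xn rmorph_nat. Qed.

End Slices.

Lemma fps_polyC_tail (R : comNzRingType) :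
  fps_polyC (rueppel_tail R) = rueppel_tail {poly R}.
Proof.
rewrite fps_polyC_sum; apply/fpsP => n; rewrite !coefs_sum.
by apply: eq_fsbigr => j _; rewrite fps_polyC_Xn.
Qed.

Lemma fps_polyC_1DX (R : comNzRingType) :
  fps_polyC (1 + fps_X : fps R) = 1 + fps_X.
Proof. by apply/fpsP => n /=; rewrite rmorphD /= rmorph_nat; case: n. Qed.

(** Comparing the coefficients of [b^k] in [(u + b s) h = 1] gives the
    two-term recurrence of a geometric sequence of ratio [- s / u]. *)
Lemma fps_slice_inv_affine (R : comUnitRingType) (u s : fps R)
    (h : fps {poly R}) k :
  u \is a GRing.unit ->
  (fps_polyC u + fps_const 'X * fps_polyC s) * h = 1 ->
  fps_slice k h = u^-1 * (- s / u) ^+ k.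
Proof.
move=> Uu hE; have slE j : u * fps_slice j h
    + (if j is j'.+1 then s * fps_slice j' h else 0) = (j == 0%N)%:R.
  rewrite -fps_slice1 -hE mulrDl fps_sliceD fps_slice_polyCM -mulrA.
  by rewrite fps_slice_bM; case: j => // j; rewrite fps_slice_polyCM.
elim: k => [|k IHk].
  have := slE 0%N; rewrite addr0 expr0 mulr1 => /(canRL (mulKr Uu)) ->.
  by rewrite mulr1.
have/eqP := slE k.+1; rewrite addr_eq0 => /eqP /(canRL (mulKr Uu)) ->.
by rewrite IHk exprS; move: (_ ^+ k) => E; rewrite !mulNr mulrA.
Qed.

(** * The coefficient array *)

Lemma fps_1DX_unit (R : comUnitRingType) :
  (1 + fps_X : fps R) \is a GRing.unit.
Proof.
by rewrite unfold_in /= /fps_unit /= addr0 unitr1.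
Qed.

Theorem proposition20 :
  let g : fps int := -1 / (1 + fps_X) in
  let f : fps int :=
    - (fps_X ^+ 3 * fps_comp rueppel (fps_X ^+ 4)) / (1 + fps_X) in
  stretched_riordan_pair g f /\
  forall n k : nat, coef_array r_b1_1 n k = riordan_array g f n.+1 k.
Proof.
move=> g f; have Uu := fps_1DX_unit int.
have fE : f = - rueppel_tail int / (1 + fps_X) by rewrite rueppel_tailE.
split.
  split.
  - rewrite /g mulN1r coefsN oppr_eq0; apply/eqP => u0.
    have /fpsP /(_ 0%N) := mulVr Uu; rewrite coefsM big_ord1 u0 mul0r => /eqP.
    by rewrite eq_sym oner_eq0.
  - by rewrite /f mulNr coefsN -mulrA coefs_XnM oppr0.
  - rewrite fE; apply: contraNneq (rueppel_tail_neq0 int) => f0.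
    rewrite -[rueppel_tail _]opprK -(divrK Uu (- rueppel_tail int)) f0.
    by rewrite mul0r oppr0.
move=> n k; rewrite /coef_array /riordan_array /r_b1_1.
set N := 1 + _; rewrite -/(rueppel_tail {poly int}).
set D := 1 + fps_X + _.
have UD : D \is a GRing.unit.
  rewrite unfold_in /= /fps_unit /D coefsD coefs_constM.
  by rewrite rueppel_tailE coefs_XnM /= mulr0 !addr0 unitr1.
have XN : fps_X * N = D - 1.
  rewrite /N /D mulrDr mulr1 mulrCA -[X in _ * (X * _)]expr1 fps_XnM_sum.
  rewrite -(addrA 1) [1 + _ in RHS]addrC addrK; congr (_ + _ * _).
  apply/fpsP => m; rewrite !coefs_sum; apply: eq_fsbigr => j.
  rewrite inE => j2; rewrite -exprD addnBA ?add1n ?subSS //.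
  by rewrite (leq_exp2l 1) // ltnW.
have XR : fps_X * (N / D) = 1 - D^-1 by rewrite mulrA XN mulrBl divrr // mul1r.
have DV : (fps_polyC (1 + fps_X) + fps_const 'X * fps_polyC (rueppel_tail int))
          * D^-1 = 1.
  by rewrite fps_polyC_1DX fps_polyC_tail divrr.
have -> : coefs (N / D) n = - coefs D^-1 n.+1.
  have /fpsP /(_ n.+1) := XR; rewrite coefs_XM (coefsD 1 (- D^-1)) coefsN.
  by rewrite coefs1 add0r.
rewrite coefN -[LHS]/(- coefs (fps_slice k D^-1) n.+1).
rewrite (fps_slice_inv_affine k Uu DV) fE /g mulN1r.
by rewrite (mulNr _ (_ ^+ k)) coefsN.
Qed.
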